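(* Let $f:\mathbb{R}^n\to\mathbb{R}$ be continuously differentiable, $g:\mathbb{R}^m\to(-\infty,+\infty]$ proper, convex and lower semicontinuous, $A\in\mathbb{R}^{m\times n}$, and $F(x)=f(x)+g(Ax)$. Suppose that for any $x^0\in\mathrm{dom}\,F$ the level set $\mathcal{L}_F(x^0):=\{x:F(x)\le F(x^0)\}$ is compact, and that $f$ is $L$-smooth. Let $\{x^k\}$ be an (infinite) sequence generated by the preconditioned proximal gradient method with conjugate momentum described in the context. Then $\{x^k\}$ has at least one accumulation point, and any accumulation point $x^*$ of $\{x^k\}$ is a stationary point of $F$.
   Context: Notation: $\|\cdot\|$ is the Euclidean norm; $\|x\|_H=\sqrt{\langle x,Hx\rangle}$ for $H$ symmetric positive definite; $U\preceq V$ means $V-U$ is positive semidefinite; $\mathrm{dom}\,F=\mathrm{dom}(g\circ A)=\{x:g(Ax)<+\infty\}$; $f$ is $L$-smooth if $\|\nabla f(x)-\nabla f(y)\|\le L\|x-y\|$ for all $x,y$; $\mathbb{N}=\{0,1,2,\dots\}$. A point $x^*$ is stationary for $F$ if $0\in\nabla f(x^* )+\partial(g\circ A)(x^* )$, where $\partial$ is the convex subdifferential. The method (preconditioned proximal gradient method with conjugate momentum). Inputs: $x^0\in\mathrm{dom}(g\circ A)$, constants $0<c_1\le c_2$, $0<c_3\le c_4$, $\sigma,\gamma\in(0,1)$, and a finite-difference parameter $\epsilon>0$. For $k=0,1,2,\dots$: 1. Choose any symmetric matrix $P_k$ with $c_3I_n\preceq P_k\preceq c_4I_n$. 2. Let $v_k$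 be the solution of $\min_{v\in\mathbb{R}^n}\nabla f(x^k)^\top v+g(Ax^k+Av)+\frac12\|v\|_{P_k}^2$. If $v_k=0$, stop and return $x^k$. 3. If $k=0$, set $d_0=v_0$. If $k\ge1$: (a) Set $s_k=d_{k-1}$ if $x^k+d_{k-1}\in\mathrm{dom}(g\circ A)$, and otherwise $s_k=\Pi^{P_k}_{\mathrm{dom}(g\circ A)}(x^k+d_{k-1})-x^k$, where $\Pi_C^H(x)=\arg\min_{y\in C}\|y-x\|_H$ for a nonempty closed convex set $C$ (so $\mathrm{dom}(g\circ A)$ is understood to be closed whenever this second case is used). (b) For $v\in\mathbb{R}^n$ let $H_k(v)=\frac1\epsilon(\nabla f(x^k+\epsilon v)-\nabla f(x^k))$ and $$q_k(v)=\begin{cases}\max\{c_1,\min\{v^\top H_k(v)/\|v\|^2,\,c_2\}\}, & v^\top H_k(v)>0,\\ \max\{c_1,\min\{\|H_k(v)\|/\|v\|,\,c_2\}\}, & v^\top H_k(v)<0,\\ c_1, & v^\top H_k(v)=0.\end{cases}$$ (c) Set $\tilde s_k=s_k-\dfrac{s_k^\top H_k(v_k)}{q_k(v_k)\|v_k\|^2}v_k$. (d) Let $\alpha_1^k$ be a minimizer over $\alpha_1\in\mathbb{R}$ of $\nabla f(x^k)^\top v_k\,\alpha_1+g(Ax^k+\alpha_1Av_k)+\frac{q_k(v_k)}2\|v_k\|^2\alpha_1^2$, and $\alpha_2^k$ a minimizer over $\alpha_2\in\mathbb{R}$ of $\nabla f(x^k)^\top\tilde s_k\,\alpha_2+g(Ax^k+\alpha_2A\tilde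 s_k)+\frac{q_k(\tilde s_k)}2\|\tilde s_k\|^2\alpha_2^2$. (e) Set $\tilde d_k=\alpha_1^kv_k+\alpha_2^k\tilde s_k$ and $q_{k,d}=q_k(v_k)\|\alpha_1^kv_k\|^2+q_k(\tilde s_k)\|\alpha_2^k\tilde s_k\|^2$. (f) Let $\alpha_3^k$ be a minimizer over $\alpha_3\in\mathbb{R}$ of $\nabla f(x^k)^\top\tilde d_k\,\alpha_3+g(Ax^k+\alpha_3A\tilde d_k)+\frac{q_{k,d}}2\alpha_3^2$, and set $d_k=\alpha_3^k\tilde d_k$. 4. Set $$t_k=\max\left\{\gamma^j:\ j\in\mathbb{N},\ F(x^k+\gamma^jd_k)-F(x^k)\le\sigma\gamma^j\left(\nabla f(x^k)^\top d_k+g(Ax^k+Ad_k)-g(Ax^k)\right)\right\}.$$ 5. Set $x^{k+1}=x^k+t_kd_k$. *)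

(* Defs.v *)
From HB Require Import structures.
From mathcomp Require Import all_boot all_order all_algebra.
From mathcomp Require Import all_classical all_reals all_analysis.

Set Implicit Arguments.
Unset Strict Implicit.
Unset Printing Implicit Defensive.

Import Order.TTheory GRing.Theory Num.Theory.
Import numFieldNormedType.Exports.

Local Open Scope classical_set_scope.
Local Open Scope ring_scope.

(* The library's norm on matrices is the sup norm: it is used only through its
   topology, and every quantitative statement below uses the Euclidean norm
   [enorm]. *)

Definition dotv {R : realType} {n : nat} (u v : 'cV[R]_n) : R :=
  \sum_(i < n) u i 0 * v i 0.

Definition enorm {R : realType} {n : nat} (u : 'cV[R]_n) : R :=
  Num.sqrt (dotv u u).

Definition hnorm {R : realType} {n : nat} (H : 'M[R]_n) (u : 'cV[R]_n) : R :=
  Num.sqrt (dotv u (H *m u)).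

Definition psdmx {R : realType} {n : nat} (M : 'M[R]_n) : Prop :=
  M^T = M /\ forall u : 'cV[R]_n, 0 <= dotv u (M *m u).

Definition loewner_le {R : realType} {n : nat} (U V : 'M[R]_n) : Prop :=
  psdmx (V - U).

(* Gradient for the Euclidean inner product; meaningful where f is
   differentiable. *)
Definition grad {R : realType} {n : nat} (f : 'cV[R]_n -> R) (x : 'cV[R]_n) :
  'cV[R]_n := \col_(i < n) 'd f x (delta_mx i 0).

Definition continuously_differentiable {R : realType} {n : nat}
    (f : 'cV[R]_n -> R) : Prop :=
  (forall x : 'cV[R]_n, differentiable f x) /\ continuous (grad f).

Definition L_smooth {R : realType} {n : nat} (L : R) (f : 'cV[R]_n -> R) : Prop :=
  forall x y : 'cV[R]_n, enorm (grad f x - grad f y) <= L * enorm (x - y).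

Definition edom {R : realType} {n : nat} (h : 'cV[R]_n -> \bar R) :
  set 'cV[R]_n := [set x | (h x < +oo)%E].

Definition eproper {R : realType} {n : nat} (h : 'cV[R]_n -> \bar R) : Prop :=
  (forall x, h x != -oo%E) /\ edom h !=set0.

(* The library's [convex_function] only covers real-valued functions. *)
Definition econvex {R : realType} {n : nat} (h : 'cV[R]_n -> \bar R) : Prop :=
  forall (x y : 'cV[R]_n) (t : R), 0 < t < 1 ->
    (h (t *: x + (1 - t) *: y)%R <= t%:E * h x + (1 - t)%:E * h y)%E.

Definition subdifferential {R : realType} {n : nat} (h : 'cV[R]_n -> \bar R)
    (x : 'cV[R]_n) : set 'cV[R]_n :=
  [set u | edom h x /\ forall y : 'cV[R]_n, (h x + (dotv u (y - x)%R)%:E <= h y)%E].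

Definition precomp {R : realType} {m n : nat} (g : 'cV[R]_m -> \bar R)
    (A : 'M[R]_(m, n)) (x : 'cV[R]_n) : \bar R := g (A *m x).

Definition objective {R : realType} {m n : nat} (f : 'cV[R]_n -> R)
    (g : 'cV[R]_m -> \bar R) (A : 'M[R]_(m, n)) (x : 'cV[R]_n) : \bar R :=
  ((f x)%:E + g (A *m x)%R)%E.

Definition stationary {R : realType} {m n : nat} (f : 'cV[R]_n -> R)
    (g : 'cV[R]_m -> \bar R) (A : 'M[R]_(m, n)) (x : 'cV[R]_n) : Prop :=
  [set grad f x + u | u in subdifferential (precomp g A) x] 0.

(* Minimizers need not be unique, so "argmin" is a set, and the quantities the
   method obtains by minimization are specified by membership in it. *)
Definition argmin {T : Type} {disp : Order.disp_t} {Y : porderType disp}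
    (C : set T) (h : T -> Y) : set T :=
  [set a | C a /\ forall b, C b -> (h a <= h b)%O].

Definition hproj {R : realType} {n : nat} (H : 'M[R]_n) (C : set 'cV[R]_n)
    (x : 'cV[R]_n) : set 'cV[R]_n := argmin C (fun y => hnorm H (y - x)).

Definition prox_model {R : realType} {m n : nat} (f : 'cV[R]_n -> R)
    (g : 'cV[R]_m -> \bar R) (A : 'M[R]_(m, n)) (P : 'M[R]_n)
    (x v : 'cV[R]_n) : \bar R :=
  ((dotv (grad f x) v)%:E + g (A *m x + A *m v)%R
    + (hnorm P v ^+ 2 / 2)%:E)%E.

Definition line_model {R : realType} {m n : nat} (f : 'cV[R]_n -> R)
    (g : 'cV[R]_m -> \bar R) (A : 'M[R]_(m, n)) (x w : 'cV[R]_n) (q a : R) :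
    \bar R :=
  ((dotv (grad f x) w * a)%:E + g (A *m x + a *: (A *m w))%R
    + (q / 2 * a ^+ 2)%:E)%E.

(* H_k(v), with x = x^k. *)
Definition grad_diff {R : realType} {n : nat} (f : 'cV[R]_n -> R) (eps : R)
    (x v : 'cV[R]_n) : 'cV[R]_n :=
  eps^-1 *: (grad f (x + eps *: v) - grad f x).

(* q_k(v), with H = H_k.  Since H_k(0) = 0, the quotients are only taken at
   nonzero v. *)
Definition curvature {R : realType} {n : nat} (c1 c2 : R)
    (H : 'cV[R]_n -> 'cV[R]_n) (v : 'cV[R]_n) : R :=
  if 0 < dotv v (H v) then
    Num.max c1 (Num.min (dotv v (H v) / enorm v ^+ 2) c2)
  else if dotv v (H v) < 0 then
    Num.max c1 (Num.min (enorm (H v) / enorm v) c2)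
  else c1.

(* s is the momentum s_k computed from x = x^k, P = P_k, dprev = d_{k-1}.  The
   projection is only meant for a closed domain. *)
Definition momentum {R : realType} {m n : nat} (g : 'cV[R]_m -> \bar R)
    (A : 'M[R]_(m, n)) (P : 'M[R]_n) (x dprev s : 'cV[R]_n) : Prop :=
  let D := edom (precomp g A) in
  (D (x + dprev) /\ s = dprev) \/
  [/\ ~ D (x + dprev), closed D &
      exists2 p, hproj P D (x + dprev) p & s = p - x].

(* d is a direction d_k, k >= 1, that can be obtained from x = x^k, P = P_k,
   v = v_k and dprev = d_{k-1}; st and dt are s_k and d_k with a tilde. *)
Definition conjugate_direction {R : realType} {m n : nat} (f : 'cV[R]_n -> R)
    (g : 'cV[R]_m -> \bar R) (A : 'M[R]_(m, n)) (c1 c2 eps : R)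
    (P : 'M[R]_n) (x v dprev d : 'cV[R]_n) : Prop :=
  exists (s : 'cV[R]_n) (a1 a2 a3 : R),
    let H := grad_diff f eps x in
    let q := curvature c1 c2 H in
    let st := s - (dotv s (H v) / (q v * enorm v ^+ 2)) *: v in
    let dt := a1 *: v + a2 *: st in
    let qd := q v * enorm (a1 *: v) ^+ 2 + q st * enorm (a2 *: st) ^+ 2 in
    [/\ momentum g A P x dprev s,
        argmin setT (line_model f g A x v (q v * enorm v ^+ 2)) a1,
        argmin setT (line_model f g A x st (q st * enorm st ^+ 2)) a2,
        argmin setT (line_model f g A x dt qd) a3 &
        d = a3 *: dt].

Definition armijo_steps {R : realType} {m n : nat} (f : 'cV[R]_n -> R)
    (g : 'cV[R]_m -> \bar R) (A : 'M[R]_(m, n)) (sigma gamma : R)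
    (x d : 'cV[R]_n) : set R :=
  [set gamma ^+ j | j in [set j : nat |
    (objective f g A (x + gamma ^+ j *: d)%R - objective f g A x <=
     (sigma * gamma ^+ j)%:E *
       ((dotv (grad f x) d)%:E + g (A *m x + A *m d)%R - g (A *m x)%R))%E]].

(* x is an infinite sequence of iterates of the preconditioned proximal gradient
   method with conjugate momentum: v k != 0 says that it never stops. *)
Definition ppg_conjugate_momentum {R : realType} {m n : nat}
    (f : 'cV[R]_n -> R) (g : 'cV[R]_m -> \bar R) (A : 'M[R]_(m, n))
    (c1 c2 c3 c4 sigma gamma eps : R) (x : nat -> 'cV[R]_n) : Prop :=
  edom (precomp g A) (x 0%N) /\
  exists (P : nat -> 'M[R]_n) (v d : nat -> 'cV[R]_n) (t : nat -> R),
    forall k : nat,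
      [/\ [/\ (P k)^T = P k, loewner_le c3%:M (P k) & loewner_le (P k) c4%:M],
          argmin setT (prox_model f g A (P k) (x k)) (v k) /\ v k != 0,
          (if k is k'.+1
           then conjugate_direction f g A c1 c2 eps (P k) (x k) (v k) (d k') (d k)
           else d k = v k),
          (armijo_steps f g A sigma gamma (x k) (d k) (t k) /\
           ubound (armijo_steps f g A sigma gamma (x k) (d k)) (t k)) &
          x k.+1 = x k + t k *: d k].

(* Main.v *)
Require Import Defs.
From HB Require Import structures.
From mathcomp Require Import all_boot all_order all_algebra.
From mathcomp Require Import all_classical all_reals all_analysis.
From mathcomp Require Import ring lra.

Import Order.TTheory GRing.Theory Num.Theory.
Import numFieldNormedType.Exports.

Local Open Scope classical_set_scope.
Local Open Scope ring_scope.

Set Implicit Arguments.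
Unset Strict Implicit.
Unset Printing Implicit Defensive.

(** Write [h u = <grad f x, u> + g (A (x + u))] for the objective linearized at an
    iterate [x], up to the constant [f x]; it is convex in the displacement [u].
    If [v] minimizes [h] plus a quadratic [N] homogeneous of degree 2, comparing [v]
    with [t v] as [t -> 1] gives [h v - h 0 <= - 2 N v]
    ([ray_minimizer_descent]). Applied to the proximal step this yields
    [h v - h 0 <= - c3 |v|^2]. The two one-dimensional minimizations then give
    points [a1 v] and [a2 w] whose regularized values are respectively at most
    [h 0 - const |v|^2] and at most [h 0]; testing the third minimization at 1/2
    and using convexity gives a direction [d] with
    [h d - h 0 <= - kappa |d|^2] and [h d - h 0 <= - kappa |v|^2] for a constant
    [kappa > 0] independent of the iteration ([direction_descent]). Nothing about
    the momentum vector or the projection is needed for this.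

    Since the gradient is Lipschitz, the first estimate makes the line search accept
    every small enough power of [gamma], so the steps are bounded below
    ([armijo_step_lower_bound]); the second one then makes every iteration decrease
    the objective by at least [beta |v_k|^2] ([iterates_descent]). The iterates
    therefore stay in a compact level set and have a cluster point. By lower
    semicontinuity the objective values stay above the value at any cluster point
    ([cluster_objective_le]), hence [v_k] tends to 0, and the optimality condition
    of the proximal steps passes to the limit ([cluster_stationary]). *)

(** * The Euclidean inner product *)

Lemma dotvC (R : realType) n (u v : 'cV[R]_n) : dotv u v = dotv v u.
Proof. by apply: eq_bigr => i _; rewrite mulrC. Qed.

Lemma dotvDr (R : realType) n (u v w : 'cV[R]_n) :
  dotv u (v + w) = dotv u v + dotv u w.
Proof. by rewrite -big_split; apply: eq_bigr => i _; rewrite mxE mulrDr. Qed.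

Lemma dotvDl (R : realType) n (u v w : 'cV[R]_n) :
  dotv (v + w) u = dotv v u + dotv w u.
Proof. by rewrite dotvC dotvDr !(dotvC u). Qed.

Lemma dotvZr (R : realType) n (a : R) (u v : 'cV[R]_n) :
  dotv u (a *: v) = a * dotv u v.
Proof. by rewrite /dotv mulr_sumr; apply: eq_bigr => i _; rewrite mxE mulrCA. Qed.

Lemma dotvZl (R : realType) n (a : R) (u v : 'cV[R]_n) :
  dotv (a *: u) v = a * dotv u v.
Proof. by rewrite dotvC dotvZr dotvC. Qed.

Lemma dotvNr (R : realType) n (u v : 'cV[R]_n) : dotv u (- v) = - dotv u v.
Proof. by rewrite -scaleN1r dotvZr mulN1r. Qed.

Lemma dotvNl (R : realType) n (u v : 'cV[R]_n) : dotv (- u) v = - dotv u v.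
Proof. by rewrite dotvC dotvNr dotvC. Qed.

Lemma dotv0 (R : realType) n (u : 'cV[R]_n) : dotv u 0 = 0.
Proof. by rewrite -(scale0r 0) dotvZr mul0r. Qed.

Lemma dotv_ge0 (R : realType) n (u : 'cV[R]_n) : 0 <= dotv u u.
Proof. by apply: sumr_ge0 => i _; exact: sqr_ge0. Qed.

Lemma dotv_eq0 (R : realType) n (u : 'cV[R]_n) : dotv u u = 0 -> u = 0.
Proof.
move=> /eqP; rewrite psumr_eq0 => [/allP u0|i _]; last exact: sqr_ge0.
apply/colP => i; rewrite mxE.
by have := u0 i (mem_index_enum i); rewrite /= mulf_eq0 orbb => /eqP.
Qed.

Lemma sqr_coord_le_dotv (R : realType) n (u : 'cV[R]_n) (i : 'I_n) :
  u i 0 ^+ 2 <= dotv u u.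
Proof.
by rewrite /dotv (bigD1 i) //= -expr2 lerDl sumr_ge0 // => j _; exact: sqr_ge0.
Qed.

Lemma sqr_enorm (R : realType) n (u : 'cV[R]_n) : enorm u ^+ 2 = dotv u u.
Proof. by rewrite sqr_sqrtr // dotv_ge0. Qed.

Lemma enormZ (R : realType) n (a : R) (u : 'cV[R]_n) :
  enorm (a *: u) = `|a| * enorm u.
Proof.
by rewrite /enorm dotvZl dotvZr mulrA -expr2 sqrtrM ?sqr_ge0// sqrtr_sqr.
Qed.

Lemma enorm_ge0 (R : realType) n (u : 'cV[R]_n) : 0 <= enorm u.
Proof. exact: sqrtr_ge0. Qed.

Lemma dotv_le_enorm (R : realType) n (u v : 'cV[R]_n) :
  dotv u v <= enorm u * enorm v.
Proof.
have := dotv_ge0 (enorm v *: u - enorm u *: v).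
rewrite dotvDl !dotvDr !dotvNr !dotvNl !dotvZl !dotvZr -!sqr_enorm (dotvC v u).
set a := enorm u; set b := enorm v => H.
have a0 : 0 <= a := enorm_ge0 u; have b0 : 0 <= b := enorm_ge0 v.
have [ab0|ab0] := eqVneq (a * b) 0; last first.
  have ab : 0 < a * b by rewrite lt_neqAle eq_sym ab0 mulr_ge0.
  rewrite -(ler_pM2l ab); nra.
rewrite ab0; move/eqP: ab0; rewrite mulf_eq0 => /orP[]/eqP z0.
- have u0 : u = 0 by apply: dotv_eq0; rewrite -sqr_enorm -/a z0 expr0n.
  by rewrite u0 dotvC dotv0.
- have v0 : v = 0 by apply: dotv_eq0; rewrite -sqr_enorm -/b z0 expr0n.
  by rewrite v0 dotv0.
Qed.

Lemma dotv_sum_delta (R : realType) n (u : 'cV[R]_n) :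
  u = \sum_(i < n) u i 0 *: delta_mx i 0.
Proof.
by rewrite {1}(matrix_sum_delta u); apply: eq_bigr => i _; rewrite big_ord1.
Qed.

(** The parallelogram law, with one of the two diagonals dropped. *)
Lemma qform_add_le (R : realType) n (P : 'M[R]_n) (u w : 'cV[R]_n) :
  0 <= dotv (u - w) (P *m (u - w)) ->
  dotv (u + w) (P *m (u + w)) <= 2 * dotv u (P *m u) + 2 * dotv w (P *m w).
Proof.
rewrite !(mulmxDr, mulmxN) !(dotvDl, dotvDr, dotvNl, dotvNr); lra.
Qed.

Lemma loewner_scalar_le (R : realType) n (c : R) (P : 'M[R]_n) :
  loewner_le c%:M P -> forall u, c * dotv u u <= dotv u (P *m u).
Proof.
move=> [_ H] u; have := H u.
by rewrite mulmxBl dotvDr dotvNr mul_scalar_mx dotvZr subr_ge0.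
Qed.

Lemma loewner_le_scalar (R : realType) n (c : R) (P : 'M[R]_n) :
  loewner_le P c%:M -> forall u, dotv u (P *m u) <= c * dotv u u.
Proof.
move=> [_ H] u; have := H u.
by rewrite mulmxBl dotvDr dotvNr mul_scalar_mx dotvZr subr_ge0.
Qed.

(** * Convexity and minimizers of quadratically regularized models *)

Lemma econvex_fin_le (R : realType) n (h : 'cV[R]_n -> \bar R)
    (hN : forall u, h u != -oo%E) (hc : econvex h) u w (a b t : R) :
  h u = a%:E -> h w = b%:E -> 0 <= t <= 1 ->
  exists2 c, h (t *: u + (1 - t) *: w) = c%:E & c <= t * a + (1 - t) * b.
Proof.
move=> hu hw /andP[t0 t1].
have [->|tn0] := eqVneq t 0.
  by exists b; [rewrite scale0r add0r subr0 scale1r|rewrite subr0 mul0r mul1r add0r].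
have [->|tn1] := eqVneq t 1.
  by exists a; [rewrite subrr scale0r addr0 scale1r|rewrite subrr mul0r mul1r addr0].
have t01 : 0 < t < 1 by rewrite !lt_neqAle eq_sym tn0 t0 tn1 t1.
have := hc u w t t01; rewrite hu hw -!EFinM -EFinD.
have := hN (t *: u + (1 - t) *: w).
by case: (h _) => // c _; rewrite lee_fin; exists c.
Qed.

(** If [v] minimizes, on the segment from 0 to [v], the sum of [h] and of a
    regularization equal to [N t^2] at [t v], then [h v] lies below [h 0] by twice
    the regularization [N]. *)
Lemma ray_minimizer_descent (R : realType) n (h : 'cV[R]_n -> \bar R)
    (hN : forall u, h u != -oo%E) (hc : econvex h) (v : 'cV[R]_n) (h0 N : R) :
  h 0 = h0%:E -> 0 <= N ->
  (forall t, 0 <= t <= 1 ->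
     (h v + N%:E <= h (t *: v) + (N * t ^+ 2)%:E)%E) ->
  exists2 p, h v = p%:E & p - h0 <= - (2 * N).
Proof.
move=> hh0 N0 vmin.
have := vmin 0; rewrite lexx ler01 scale0r hh0 => /(_ isT).
case hv : (h v) (hN v) => [p| |] // _ _; exists p => //.
rewrite leNgt; apply/negP => gap.
(* [t] close enough to 1 that [(1 - t) N] is less than the violation. *)
have [t /andP[t0 t1] tN] : exists2 t, 0 < t < 1 & (1 - t) * N < p - h0 + 2 * N.
  pose D := p - h0 + 2 * N.
  have D0 : 0 < D by rewrite /D; lra.
  exists (1 - D / (D + N + 1)); last first.
    rewrite opprB addrC subrK -/D mulrAC ltr_pdivrMr; nra.
  rewrite subr_gt0 ltr_pdivrMr; last lra.
  rewrite ltrBlDr ltrDl divr_gt0 //; last lra.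
  by rewrite mul1r andbT; lra.
have t01 : 0 <= t <= 1 by rewrite !ltW.
have [c hc1 hc2] := econvex_fin_le hN hc hv hh0 t01.
move: (vmin t t01); rewrite scaler0 addr0 in hc1.
rewrite hv hc1 -!EFinD lee_fin => H.
have : (1 - t) * (p - h0) <= (1 - t) * (- (1 + t) * N) by nra.
rewrite ler_pM2l; nra.
Qed.

Lemma line_minimizer_descent (R : realType) n (h : 'cV[R]_n -> \bar R)
    (hN : forall u, h u != -oo%E) (hc : econvex h) (w : 'cV[R]_n) (h0 q a : R) :
  h 0 = h0%:E -> 0 <= q ->
  (forall b, (h (a *: w) + (q / 2 * a ^+ 2)%:E <=
              h (b *: w) + (q / 2 * b ^+ 2)%:E)%E) ->
  exists2 p, h (a *: w) = p%:E & p - h0 <= - (q * a ^+ 2).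
Proof.
move=> hh0 q0 amin.
have Q0 : 0 <= q / 2 * a ^+ 2 by rewrite mulr_ge0 ?sqr_ge0// divr_ge0.
have [|p hp ple] := ray_minimizer_descent hN hc hh0 Q0 (v := a *: w).
  move=> t _; rewrite scalerA; have := amin (t * a).
  by rewrite exprMn (mulrC (t ^+ 2)) (mulrA _ (a ^+ 2)).
by exists p => //; apply: le_trans ple _; lra.
Qed.

(** Here [w] is an arbitrary second vector. The third minimizer is compared with the
    midpoint [dt / 2] of [a1 v] and [a2 w]: halving divides the quadratic term by 4
    but, by convexity, the decrease of [h] only by 2. *)
Lemma conjugate_combination_descent (R : realType) n (h : 'cV[R]_n -> \bar R)
    (hN : forall u, h u != -oo%E) (hc : econvex h) (v w : 'cV[R]_n)
    (c1 c2 c3 q1 q2 a1 a2 a3 h0 pv : R) :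
  let dt := a1 *: v + a2 *: w in
  let qd := q1 * dotv (a1 *: v) (a1 *: v) + q2 * dotv (a2 *: w) (a2 *: w) in
  0 < c1 -> 0 < c3 -> c1 <= q1 <= c2 -> c1 <= q2 ->
  h 0 = h0%:E -> h v = pv%:E -> pv - h0 <= - (c3 * dotv v v) ->
  (forall b, (h (a1 *: v) + (q1 * dotv v v / 2 * a1 ^+ 2)%:E <=
              h (b *: v) + (q1 * dotv v v / 2 * b ^+ 2)%:E)%E) ->
  (forall b, (h (a2 *: w) + (q2 * dotv w w / 2 * a2 ^+ 2)%:E <=
              h (b *: w) + (q2 * dotv w w / 2 * b ^+ 2)%:E)%E) ->
  (forall b, (h (a3 *: dt) + (qd / 2 * a3 ^+ 2)%:E <=
              h (b *: dt) + (qd / 2 * b ^+ 2)%:E)%E) ->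
  exists p, [/\ h (a3 *: dt) = p%:E,
    p - h0 <= - (c1 / 2 * dotv (a3 *: dt) (a3 *: dt)) &
    p - h0 <= - (Num.min 1 (c3 / c2) * c3 / 4 * dotv v v)].
Proof.
move=> dt qd c10 c30 /andP[c1q1 q1c2] c1q2 hh0 hv pvle min1 min2 min3.
have c20 : 0 < c2 by lra.
have V0 := dotv_ge0 v; have W0 := dotv_ge0 w.
set V := dotv v v in V0 pvle min1 *; set W := dotv w w in W0 min2.
pose Q1 := q1 * dotv (a1 *: v) (a1 *: v).
pose Q2 := q2 * dotv (a2 *: w) (a2 *: w).
have qdE : qd = Q1 + Q2 by [].
clearbody qd.
have Q1E : q1 * V / 2 * a1 ^+ 2 = Q1 / 2.
  by rewrite /Q1 dotvZl dotvZr -/V; field.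
have Q2E : q2 * W / 2 * a2 ^+ 2 = Q2 / 2.
  by rewrite /Q2 dotvZl dotvZr -/W; field.
have Q1ge : c1 * dotv (a1 *: v) (a1 *: v) <= Q1 by rewrite ler_wpM2r// dotv_ge0.
have Q2ge : c1 * dotv (a2 *: w) (a2 *: w) <= Q2 by rewrite ler_wpM2r// dotv_ge0.
have Q10 : 0 <= Q1 by apply: le_trans Q1ge; rewrite mulr_ge0 ?dotv_ge0 ?ltW.
have Q20 : 0 <= Q2 by apply: le_trans Q2ge; rewrite mulr_ge0 ?dotv_ge0 ?ltW.
have [|p1 hp1 _] := line_minimizer_descent hN hc hh0 _ min1.
  by rewrite mulr_ge0//; lra.
have [|p2 hp2 _] := line_minimizer_descent hN hc hh0 _ min2.
  by rewrite mulr_ge0//; lra.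
have [|p3 hp3 p3le] := line_minimizer_descent hN hc hh0 _ min3.
  by rewrite qdE addr_ge0.
set tau := Num.min 1 (c3 / c2).
have tau1 : tau <= 1 by rewrite ge_min lexx.
have tau2 : tau * c2 <= c3 by rewrite -ler_pdivlMr// ge_min lexx orbT.
have tau0 : 0 < tau by rewrite lt_min ltr01 divr_gt0.
(* The first minimizer is compared with [tau v]; [tau <= c3 / c2] ensures that the
   quadratic term uses up at most half of the decrease of [h]. *)
have m1 : p1 - h0 + Q1 / 2 <= - (tau * c3 / 2 * V).
  have tau01 : 0 <= tau <= 1 by rewrite ltW.
  have [c hcE cle] := econvex_fin_le hN hc hv hh0 tau01.
  move: (min1 tau); rewrite scaler0 addr0 in hcE.
  rewrite hp1 hcE Q1E -!EFinD lee_fin => m1.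
  have A1 : tau * (pv - h0) <= tau * (- (c3 * V)) by rewrite ler_pM2l.
  have A2 : q1 * tau <= c3 by apply: le_trans tau2; rewrite mulrC ler_pM2l.
  have A3 : q1 * tau * (V * tau) <= c3 * (V * tau).
    by rewrite ler_wpM2r// mulr_ge0// ltW.
  have A4 : q1 * V / 2 * tau ^+ 2 = q1 * tau * (V * tau) / 2 by field.
  rewrite A4 in m1; lra.
have m2 : p2 - h0 + Q2 / 2 <= 0.
  move: (min2 0); rewrite hp2 scale0r hh0 expr0n mulr0 Q2E -!EFinD lee_fin; lra.
have half01 : 0 <= (2^-1 : R) <= 1 by lra.
have [c hcE cle] := econvex_fin_le hN hc hp1 hp2 half01.
have halfE : 2^-1 *: dt = 2^-1 *: (a1 *: v) + (1 - 2^-1) *: (a2 *: w).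
  by rewrite scalerDr; congr (_ + _ *: _); field.
have m3 : p3 - h0 <= - (tau * c3 / 4 * V).
  move: (min3 2^-1); rewrite hp3 halfE hcE -!EFinD lee_fin => m3.
  have : 0 <= qd / 2 * a3 ^+ 2 by rewrite mulr_ge0 ?sqr_ge0// divr_ge0// qdE addr_ge0.
  rewrite qdE in m3.
  have -> : tau * c3 / 4 * V = (tau * c3 / 2 * V) / 2 by field.
  move=> H.
  have E2 : (Q1 + Q2) / 2 * 2^-1 ^+ 2 = (Q1 + Q2) / 8 by field.
  rewrite E2 in m3; rewrite qdE in H.
  move: m1 m2; set T := _ / 2 * V => m1 m2; lra.
exists p3; split=> //.
apply: le_trans p3le _; rewrite lerN2 dotvZl dotvZr.
have -> : c1 / 2 * (a3 * (a3 * dotv dt dt)) = c1 / 2 * dotv dt dt * a3 ^+ 2.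
  by ring.
rewrite ler_wpM2r ?sqr_ge0//.
have := dotv_ge0 (a1 *: v - a2 *: w).
rewrite /dt !(dotvDl, dotvDr, dotvNl, dotvNr) (dotvC (a2 *: w) (a1 *: v)).
move: Q1ge Q2ge.
set X := dotv _ _; set Y := dotv (a2 *: w) _; set Z := dotv (a1 *: v) (a2 *: w).
rewrite qdE => Q1ge Q2ge XYZ.
have : c1 * (Z + Z) <= c1 * (X + Y) by rewrite ler_pM2l//; lra.
by lra.
Qed.

Lemma curvature_bounds (R : realType) n (c1 c2 : R) (H : 'cV[R]_n -> 'cV[R]_n) v :
  c1 <= c2 -> c1 <= curvature c1 c2 H v <= c2.
Proof.
move=> c12; rewrite /curvature; do 2?case: ifP => _; last by rewrite lexx.
- by rewrite le_max lexx ge_max c12 ge_min lexx orbT.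
- by rewrite le_max lexx ge_max c12 ge_min lexx orbT.
Qed.

(** * The first-order model at a point *)

(** The objective linearized in its smooth part around [x], as a function of the
    displacement [u], up to the constant [f x]. *)
Definition linearized {R : realType} {m n : nat} (f : 'cV[R]_n -> R)
    (g : 'cV[R]_m -> \bar R) (A : 'M[R]_(m, n)) (x u : 'cV[R]_n) : \bar R :=
  ((dotv (grad f x) u)%:E + g (A *m x + A *m u)%R)%E.

Section Linearized.
Variables (R : realType) (m n : nat).
Variables (f : 'cV[R]_n -> R) (g : 'cV[R]_m -> \bar R) (A : 'M[R]_(m, n)).
Hypotheses (g_proper : eproper g) (g_convex : econvex g).
Implicit Types x u v d : 'cV[R]_n.

Lemma linearized_neq_ninfty x u : linearized f g A x u != -oo%E.
Proof. by rewrite /linearized; move: (g_proper.1 (A *m x + A *m u)); case: (g _). Qed.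

Lemma linearized_convex x : econvex (linearized f g A x).
Proof.
move=> u w t t01; have /andP[t0 t1] := t01.
have t1' : 0 < 1 - t by rewrite subr_gt0.
rewrite /linearized.
have -> : A *m x + A *m (t *: u + (1 - t) *: w) =
    t *: (A *m x + A *m u) + (1 - t) *: (A *m x + A *m w).
  rewrite mulmxDr -!scalemxAr !scalerDr addrACA -scalerDl.
  by rewrite (addrC t) subrK scale1r.
have := g_convex (A *m x + A *m u) (A *m x + A *m w) t01.
move: (g_proper.1 (A *m x + A *m u)) (g_proper.1 (A *m x + A *m w)).
have tE : (t%:E * +oo = +oo)%E by rewrite gt0_muley ?lte_fin.
have tE' : ((1 - t)%:E * +oo = +oo)%E by rewrite gt0_muley ?lte_fin.
case: (g (A *m x + A *m u)) => [a| |] // _;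
  case: (g (A *m x + A *m w)) => [b| |] // _ H; last 3 first.
- by rewrite (addey (x := _%:E))// tE' addey ?leey.
- by rewrite (addey (x := _%:E))// tE addye ?leey// -EFinD -EFinM.
- by rewrite !(addey (x := _%:E))// tE tE' leey.
rewrite -!EFinD in H *.
apply: le_trans (leeD2l _ H) _.
rewrite -EFinD lee_fin dotvDr !dotvZr; lra.
Qed.

Lemma linearized0 x : linearized f g A x 0 = g (A *m x).
Proof. by rewrite /linearized dotv0 mulmx0 addr0 add0e. Qed.

Lemma prox_modelE P x v :
  prox_model f g A P x v = (linearized f g A x v + (hnorm P v ^+ 2 / 2)%:E)%E.
Proof. by []. Qed.

Lemma line_modelE x w q a :
  line_model f g A x w q a = (linearized f g A x (a *: w) + (q / 2 * a ^+ 2)%:E)%E.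
Proof. by rewrite /line_model /linearized dotvZr mulrC -scalemxAr. Qed.

Lemma linearized_fin_g x u p : linearized f g A x u = p%:E ->
  g (A *m x + A *m u) = (p - dotv (grad f x) u)%:E.
Proof.
rewrite /linearized; case: (g _) => // r [E]; congr _%:E; move: E => <-.
by ring.
Qed.

(** The proximal step [v] decreases the linearized objective by [c3 |v|^2]. *)
Lemma prox_step_descent P x v (c3 gx : R) :
  0 < c3 -> loewner_le c3%:M P -> g (A *m x) = gx%:E ->
  argmin setT (prox_model f g A P x) v ->
  exists2 p, linearized f g A x v = p%:E & p - gx <= - (c3 * dotv v v).
Proof.
move=> c30 /loewner_scalar_le Pge hgx [_ vmin].
have P0 u : 0 <= dotv u (P *m u).
  by apply: le_trans (Pge u); rewrite mulr_ge0 ?dotv_ge0 ?ltW.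
have N0 : 0 <= dotv v (P *m v) / 2 by rewrite divr_ge0.
have [||p hp ple] := @ray_minimizer_descent _ _ (linearized f g A x)
  (@linearized_neq_ninfty x) (@linearized_convex x) v gx _ _ N0.
- by rewrite linearized0.
- move=> t _; have := vmin (t *: v) I; rewrite !prox_modelE /hnorm.
  rewrite !sqr_sqrtr// -scalemxAr dotvZl dotvZr.
  by rewrite (mulrC (dotv _ _ / 2)) expr2 -!mulrA.
- by exists p => //; have := Pge v; lra.
Qed.

(** Whatever the momentum vector, the combined direction decreases the linearized
    objective in proportion to both [|d|^2] and [|v|^2]. *)
Lemma direction_descent P x v dprev d (c1 c2 c3 eps gx : R) :
  0 < c1 <= c2 -> 0 < c3 -> loewner_le c3%:M P -> g (A *m x) = gx%:E ->
  argmin setT (prox_model f g A P x) v ->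
  d = v \/ conjugate_direction f g A c1 c2 eps P x v dprev d ->
  let kappa := Num.min (c1 / 2) (Num.min 1 (c3 / c2) * c3 / 4) in
  exists p, [/\ linearized f g A x d = p%:E,
    p - gx <= - (kappa * dotv d d) & p - gx <= - (kappa * dotv v v)].
Proof.
move=> /andP[c10 c12] c30 Pge hgx hv hd kappa.
have [pv hpv pvle] := prox_step_descent c30 Pge hgx hv.
have k1 : kappa <= c1 / 2 by rewrite ge_min lexx.
have k2 : kappa <= Num.min 1 (c3 / c2) * c3 / 4 by rewrite ge_min lexx orbT.
case: hd => [->|[s [a1 [a2 [a3 /=]]]]].
  have k3 : kappa <= c3.
    apply: le_trans k2 _; have : Num.min 1 (c3 / c2) <= 1 by rewrite ge_min lexx.
    nra.
  have kv : kappa * dotv v v <= c3 * dotv v v by rewrite ler_wpM2r ?dotv_ge0.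
  by exists pv; split=> //; apply: le_trans pvle _; rewrite lerN2.
set H := grad_diff f eps x; set q := curvature c1 c2 H.
set w := s - _ *: v; set dt := a1 *: v + a2 *: w.
set qd := q v * _ + _ => -[_ [_ min1] [_ min2] [_ min3] ->].
have /andP[qv1 qv2] := curvature_bounds H v c12.
have /andP[qw1 qw2] := curvature_bounds H w c12.
have qv12 : c1 <= q v <= c2 by rewrite qv1.
have hh0 : linearized f g A x 0 = gx%:E by rewrite linearized0.
have [|||p [hp ple1 ple2]] := @conjugate_combination_descent _ _ _
  (@linearized_neq_ninfty x) (@linearized_convex x) v w c1 c2 c3 (q v) (q w)
  a1 a2 a3 gx pv c10 c30 qv12 qw1 hh0 hpv pvle.
- by move=> b; have := min1 b I; rewrite !line_modelE sqr_enorm.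
- by move=> b; have := min2 b I; rewrite !line_modelE sqr_enorm.
- by move=> b; have := min3 b I; rewrite !line_modelE /qd !sqr_enorm.
exists p; split=> //.
- by apply: le_trans ple1 _; rewrite lerN2 ler_wpM2r ?dotv_ge0.
- by apply: le_trans ple2 _; rewrite lerN2 ler_wpM2r ?dotv_ge0.
Qed.

End Linearized.

(** * Smoothness and the line search *)

Lemma diff_dotv_grad (R : realType) n (f : 'cV[R]_n -> R) x u :
  differentiable f x -> 'd f x u = dotv (grad f x) u.
Proof.
move=> df; rewrite {1}(dotv_sum_delta u) linear_sum.
by apply: eq_bigr => i _; rewrite linearZ mxE mulrC.
Qed.

Lemma is_derive_line (R : realType) n (f : 'cV[R]_n -> R) (x d : 'cV[R]_n) (s : R) :
  differentiable f (x + s *: d) ->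
  is_derive s 1 (fun s => f (x + s *: d)) (dotv (grad f (x + s *: d)) d).
Proof.
move=> df; have fd : derivable f (x + s *: d) d by exact: diff_derivable.
have E : (fun h : R => h^-1 *: (f (x + (h *: (1 : R) + s) *: d) - f (x + s *: d)))
    = (fun h : R => h^-1 *: (f (h *: d + (x + s *: d)) - f (x + s *: d))).
  apply/funext => h; congr (_ *: (f _ - _)).
  by rewrite scalerDl [h *: 1]mulr1 addrCA.
split; first by rewrite /derivable /= E.
by rewrite /derive /= E -(diff_dotv_grad _ df) -deriveE.
Qed.

(** The descent lemma for smooth functions, by the mean value theorem, with the
    constant [|L|] instead of the sharp [L / 2]. *)
Lemma smooth_upper_bound (R : realType) n (f : 'cV[R]_n -> R) (L t : R) x d :
  (forall y, differentiable f y) -> L_smooth L f -> 0 <= t ->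
  f (x + t *: d) - f x <= t * dotv (grad f x) d + `|L| * t ^+ 2 * dotv d d.
Proof.
move=> df fL t0.
have bound (a b : 'cV[R]_n) : enorm (a - b) <= `|L| * t * enorm d ->
    dotv a d * t <= t * dotv b d + `|L| * t ^+ 2 * dotv d d.
  move=> ab; have := le_trans (dotv_le_enorm (a - b) d)
    (ler_wpM2r (enorm_ge0 d) ab).
  by move=> /(ler_wpM2r t0); rewrite dotvDl dotvNl -sqr_enorm; lra.
have dl s := is_derive_line (df (x + s *: d)).
have [|c] := MVT_segment t0 (fun s _ => dl s).
  apply: derivable_within_continuous => s _.
  by have := dl s; case.
rewrite in_itv /= => /andP[c0 ct]; rewrite scale0r addr0 subr0 /= => ->.
apply: bound; apply: le_trans (fL _ _) _.
have -> : x + c *: d - x = c *: d by rewrite addrC addKr.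
rewrite enormZ ger0_norm// mulrA ler_wpM2r ?enorm_ge0//.
by apply: le_trans (ler_wpM2r c0 (ler_norm L)) _; rewrite ler_wpM2l.
Qed.

(** The first-order decrease dominates [kappa |d|^2]; so if [gamma ^+ J] is small
    enough for the smoothness remainder to be absorbed, the line search stops at a
    step no smaller than [gamma ^+ J]. *)
Lemma armijo_step_lower_bound (R : realType) (m n : nat) (f : 'cV[R]_n -> R)
    (g : 'cV[R]_m -> \bar R) (A : 'M[R]_(m, n)) (L sigma gamma kappa gx p t : R)
    (J : nat) (x d : 'cV[R]_n) :
  eproper g -> econvex g -> (forall y, differentiable f y) -> L_smooth L f ->
  0 < sigma < 1 -> 0 < gamma < 1 -> 0 < kappa ->
  `|L| * gamma ^+ J <= (1 - sigma) * kappa ->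
  g (A *m x) = gx%:E -> linearized f g A x d = p%:E ->
  p - gx <= - (kappa * dotv d d) ->
  armijo_steps f g A sigma gamma x d t ->
  ubound (armijo_steps f g A sigma gamma x d) t ->
  gamma ^+ J <= t /\
  exists2 gx', g (A *m (x + t *: d)) = gx'%:E &
    f (x + t *: d) + gx' <= f x + gx + sigma * t * (p - gx).
Proof.
move=> gp gc df fL /andP[s0 s1] /andP[g0 g1] k0 HJ hgx hp ple tA tU.
have RHS : ((dotv (grad f x) d)%:E + g (A *m x + A *m d)%R - g (A *m x)%R =
    (p - gx)%:E)%E by rewrite -/(linearized f g A x d) hp hgx.
have objx : objective f g A x = (f x + gx)%:E by rewrite /objective hgx.
split.
  apply: tU; exists J => //=; rewrite RHS objx.
  set s := gamma ^+ J.
  have s0' : 0 <= s by rewrite exprn_ge0// ltW.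
  have s01 : 0 <= s <= 1 by rewrite s0' exprn_ile1// ltW.
  have h0 : linearized f g A x 0 = gx%:E by rewrite linearized0.
  have [c] := econvex_fin_le (@linearized_neq_ninfty _ _ _ f g A gp x)
    (@linearized_convex _ _ _ f g A gp gc x) hp h0 s01.
  rewrite scaler0 addr0 => /linearized_fin_g hs cle.
  rewrite /objective mulmxDr hs -!EFinD -EFinM lee_fin dotvZr.
  have := @smooth_upper_bound _ _ f L s x d df fL s0'.
  have : s * (`|L| * s) * dotv d d <= s * ((1 - sigma) * kappa) * dotv d d.
    by rewrite ler_wpM2r ?dotv_ge0// ler_wpM2l.
  have : s * (1 - sigma) * (p - gx) <= s * (1 - sigma) * (- (kappa * dotv d d)).
    by rewrite ler_wpM2l// mulr_ge0// subr_ge0 ltW.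
  lra.
case: tA => j /= + <-; rewrite RHS objx /objective.
move: (gp.1 (A *m (x + gamma ^+ j *: d))); case: (g _) => // gx' _.
by rewrite -!EFinD -EFinM lee_fin => H; exists gx' => //; lra.
Qed.

(** * Limits of column vectors and lower semicontinuity *)

Lemma cvg_sumr (R : realType) (V : normedModType R) (T I : Type)
    (F : set_system T) (FF : Filter F) (r : seq I) (u : I -> T -> V) (l : I -> V) :
  (forall i, u i s @[s --> F] --> l i) ->
  \sum_(i <- r) u i s @[s --> F] --> \sum_(i <- r) l i.
Proof.
move=> ul; elim: r => [|i r IH].
  rewrite big_nil; under eq_fun do rewrite big_nil.
  exact: cvg_cst.
by rewrite big_cons; under eq_fun do rewrite big_cons; exact: cvgD.
Qed.

Section ColumnLimits.
Context {R : realType} {T : Type} {F : set_system T} {FF : Filter F}.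

Lemma cvg_coord n (u : T -> 'cV[R]_n) (a : 'cV[R]_n) i :
  u s @[s --> F] --> a -> u s i 0 @[s --> F] --> a i 0.
Proof. by move=> ua; exact: (cvg_comp _ _ ua (@coord_continuous _ _ _ i 0 a)). Qed.

Lemma cvg_col n (u : T -> 'cV[R]_n) (a : 'cV[R]_n) :
  (forall i, u s i 0 @[s --> F] --> a i 0) -> u s @[s --> F] --> a.
Proof.
move=> ua; rewrite [a]dotv_sum_delta.
have -> : u = fun s => \sum_(i < n) u s i 0 *: delta_mx i 0.
  by apply/funext => s; exact: dotv_sum_delta.
by apply: cvg_sumr => i; apply: cvgZ => //; exact: cvg_cst.
Qed.

Lemma cvg_mulmx m n (A : 'M[R]_(m, n)) (u : T -> 'cV[R]_n) (a : 'cV[R]_n) :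
  u s @[s --> F] --> a -> A *m u s @[s --> F] --> A *m a.
Proof.
move=> ua; apply: cvg_col => i; rewrite mxE; under eq_fun do rewrite mxE.
by apply: cvg_sumr => j; apply: cvgM; [exact: cvg_cst|exact: cvg_coord].
Qed.

Lemma cvg_dotv n (u v : T -> 'cV[R]_n) (a b : 'cV[R]_n) :
  u s @[s --> F] --> a -> v s @[s --> F] --> b ->
  dotv (u s) (v s) @[s --> F] --> dotv a b.
Proof.
by move=> ua vb; apply: cvg_sumr => j; apply: cvgM; exact: cvg_coord.
Qed.

Lemma cvg_lsc_mulmx m n (g : 'cV[R]_m -> \bar R) (A : 'M[R]_(m, n))
    (u : T -> 'cV[R]_n) (z : 'cV[R]_n) (a : R) :
  lower_semicontinuous g -> u s @[s --> F] --> z -> (a%:E < g (A *m z))%E ->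
  \forall s \near F, (a%:E < g (A *m u s))%E.
Proof.
move=> gl uz /gl[V nV HV].
have H : \forall s \near F, V (A *m u s) by exact: (cvg_mulmx (A := A) uz nV).
by apply: filterS H => s; exact: HV.
Qed.

Lemma cvg_dotv0 n (v : T -> 'cV[R]_n) :
  dotv (v s) (v s) @[s --> F] --> (0 : R) -> v s @[s --> F] --> (0 : 'cV[R]_n).
Proof.
move=> v0; apply: cvg_col => i; rewrite mxE; apply/cvgr0Pnorm_lt => e e0.
have e20 : 0 < e ^+ 2 by rewrite exprn_gt0.
move/cvgr0Pnorm_lt : v0 => /(_ _ e20); apply: filterS => s.
rewrite ger0_norm ?dotv_ge0// => ve.
have : `|v s i 0| ^+ 2 < e ^+ 2.
  by rewrite real_normK ?num_real//; exact: le_lt_trans (sqr_coord_le_dotv _ _) ve.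
by rewrite ltr_pXn2r // nnegrE ltW.
Qed.

End ColumnLimits.

Section LimitPoints.
Variables (R : realType) (m n : nat).
Variables (f : 'cV[R]_n -> R) (g : 'cV[R]_m -> \bar R) (A : 'M[R]_(m, n)).
Hypothesis g_lsc : lower_semicontinuous g.

(** A nonincreasing sequence of objective values stays above the value of the
    objective at every cluster point, by lower semicontinuity. *)
Lemma cluster_objective_le (x : nat -> 'cV[R]_n) (xs : 'cV[R]_n) (Fx : nat -> R) :
  continuous f -> (forall k, objective f g A (x k) = (Fx k)%:E) ->
  (forall i j, (i <= j)%N -> Fx j <= Fx i) -> cluster (x @ \oo) xs ->
  forall k, (objective f g A xs <= (Fx k)%:E)%E.
Proof.
move=> fc FxE Fx_dec xs_cl k; rewrite leNgt; apply/negP => gap.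
have [a fa ag] : exists2 a : R, Fx k - f xs < a & (a%:E < g (A *m xs))%E.
  move: gap; rewrite /objective; case: (g _) => [r| |] //=.
  - rewrite -EFinD lte_fin => gap; exists ((Fx k - f xs + r) / 2); last rewrite lte_fin.
      by lra.
    by lra.
  - by move=> _; exists (Fx k - f xs + 1); rewrite ?ltry//; lra.
have nf : \forall z \near xs, Fx k - a < f z.
  by apply: (cvgr_gt (f xs) (fc xs)); lra.
have ng : \forall z \near xs, (a%:E < g (A *m z))%E.
  exact: (@cvg_lsc_mulmx _ _ (nbhs xs) _ _ _ g A id xs a g_lsc cvg_id ag).
have late : (x @ \oo) (x @` [set j | (k <= j)%N]).
  by exists k => // j /= kj; exists j.
have [_ [[j kj <-] [fj gj]]] := xs_cl _ _ late (filterI nf ng).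
have := FxE j; rewrite /objective; move: gj.
case: (g _) => // r; rewrite lte_fin => ar [frE].
have := Fx_dec _ _ kj; rewrite -frE; lra.
Qed.

(** Optimality of the proximal step against the displacements towards [y]. The
    inequality [|v + t z|_P^2 <= 2 |v|_P^2 + 2 t^2 |z|_P^2], with [z = y - x - v],
    bounds the cross term between [v] and [z], so that the error vanishes when first
    [v] and then [t] tend to 0. *)
Lemma prox_step_variational (g_proper : eproper g) (g_convex : econvex g)
    (P : 'M[R]_n) (x v y : 'cV[R]_n) (c3 c4 t b p : R) :
  0 <= c3 -> loewner_le c3%:M P -> loewner_le P c4%:M -> 0 < t < 1 ->
  argmin setT (prox_model f g A P x) v ->
  linearized f g A x v = p%:E -> g (A *m y) = b%:E ->
  (g (A *m (x + v)) <= (b + dotv (grad f x) (y - (x + v))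
     + t * (c4 * dotv (y - (x + v)) (y - (x + v)))
     + c4 * dotv v v / (2 * t))%:E)%E.
Proof.
move=> c30 /loewner_scalar_le Pge /loewner_le_scalar Ple /andP[t0 t1] [_ vmin] hp gy.
have P0 u : 0 <= dotv u (P *m u).
  by apply: le_trans (Pge u); rewrite mulr_ge0 ?dotv_ge0.
set z := y - (x + v).
have hy : linearized f g A x (y - x) = (dotv (grad f x) (y - x) + b)%:E.
  by rewrite /linearized -mulmxDr (addrC x) subrK gy.
have t01 : 0 <= t <= 1 by rewrite !ltW.
have [c hc cle] := econvex_fin_le (@linearized_neq_ninfty _ _ _ f g A g_proper x)
  (@linearized_convex _ _ _ f g A g_proper g_convex x) hy hp t01.
have vz : v + t *: z = t *: (y - x) + (1 - t) *: v.
  rewrite /z opprD addrA scalerBr scalerBl scale1r.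
  by rewrite addrCA addrA.
have := vmin (v + t *: z) I; rewrite !prox_modelE {1}vz hc hp /hnorm !sqr_sqrtr//.
rewrite -!EFinD lee_fin => H.
have := @qform_add_le _ _ P v (t *: z) (P0 _).
rewrite -scalemxAr dotvZl dotvZr => Q.
have Pv := Ple v; have Pz := Ple z.
rewrite mulmxDr (linearized_fin_g hp) lee_fin.
have gz : dotv (grad f x) z = dotv (grad f x) (y - x) - dotv (grad f x) v.
  by rewrite -dotvNr -dotvDr /z opprD addrA.
rewrite gz.
move: (dotv (grad f x) (y - x)) (dotv (grad f x) v) hy cle gz => D1 D2 _ cle _.
have tt : 0 < t * t by rewrite mulr_gt0.
have K : t * p <= t * (D1 + b) + c4 * dotv v v / 2 + t * t * (c4 * dotv z z).
  have : t * t * dotv z (P *m z) <= t * t * (c4 * dotv z z) by rewrite ler_pM2l.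
  lra.
have -> : c4 * dotv v v / (2 * t) = t^-1 * (c4 * dotv v v / 2).
  by rewrite invfM; ring.
rewrite -(ler_pM2l t0).
have -> : t * (b + (D1 - D2) + t * (c4 * dotv z z) + t^-1 * (c4 * dotv v v / 2))
  = t * (D1 + b) + c4 * dotv v v / 2 + t * t * (c4 * dotv z z) - t * D2.
  by field; lra.
lra.
Qed.

End LimitPoints.

(** * The iterates *)

Lemma exists_exp_mul_le (R : realType) (gamma l e : R) :
  0 < gamma < 1 -> 0 <= l -> 0 < e -> exists J : nat, l * gamma ^+ J <= e.
Proof.
move=> /andP[g0 g1] l0 e0.
have e1 : 0 < e / (l + 1) by rewrite divr_gt0//; lra.
have /cvgr0Pnorm_lt /(_ _ e1) [J _ HJ] : GRing.exp gamma @ \oo --> (0 : R).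
  by apply: cvg_expr; rewrite ger0_norm// ltW.
exists J; have := HJ J (leqnn J).
rewrite /= ger0_norm; last by rewrite exprn_ge0// ltW.
rewrite ltr_pdivlMr; last lra.
have : 0 <= gamma ^+ J by rewrite exprn_ge0// ltW.
lra.
Qed.

(** The iterates stay in the domain, and each iteration decreases the objective by
    a fixed multiple of [|v_k|^2]. *)
Lemma iterates_descent (R : realType) (m n : nat)
    (f : 'cV[R]_n -> R) (g : 'cV[R]_m -> \bar R) (A : 'M[R]_(m, n))
    (L c1 c2 c3 c4 sigma gamma eps : R) (x : nat -> 'cV[R]_n) :
  (forall y, differentiable f y) -> eproper g -> econvex g -> L_smooth L f ->
  0 < c1 <= c2 -> 0 < c3 -> 0 < sigma < 1 -> 0 < gamma < 1 ->
  ppg_conjugate_momentum f g A c1 c2 c3 c4 sigma gamma eps x ->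
  exists (beta : R) (gx : nat -> R) (P : nat -> 'M[R]_n) (v : nat -> 'cV[R]_n)
    (p : nat -> R), 0 < beta /\ forall k,
    [/\ g (A *m x k) = (gx k)%:E,
        f (x k.+1) + gx k.+1 <= f (x k) + gx k - beta * dotv (v k) (v k),
        loewner_le c3%:M (P k), loewner_le (P k) c4%:M &
        argmin setT (prox_model f g A (P k) (x k)) (v k) /\
        linearized f g A (x k) (v k) = (p k)%:E].
Proof.
move=> df gp gc fL c12 c30 s01 g01 [x0 [P [v [d [t gen]]]]].
pose kappa := Num.min (c1 / 2) (Num.min 1 (c3 / c2) * c3 / 4).
have /andP[c10 c1c2] := c12; have c20 : 0 < c2 by lra.
have /andP[s0 s1] := s01; have /andP[g0 g1] := g01.
have k0 : 0 < kappa.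
  rewrite lt_min divr_gt0//= divr_gt0// mulr_gt0// lt_min ltr01 /=.
  by rewrite divr_gt0.
have [J HJ] : exists J : nat, `|L| * gamma ^+ J <= (1 - sigma) * kappa.
  by apply: exists_exp_mul_le => //; rewrite mulr_gt0// subr_gt0.
have step k (gk : R) : g (A *m x k) = gk%:E ->
    exists2 gk', g (A *m x k.+1) = gk'%:E &
      f (x k.+1) + gk' <= f (x k) + gk
        - sigma * gamma ^+ J * kappa * dotv (v k) (v k).
  move=> hgk; have [[_ Pge _] [vmin _] dk [tA tU] ->] := gen k.
  have dk' : exists dprev, d k = v k \/
      conjugate_direction f g A c1 c2 eps (P k) (x k) (v k) dprev (d k).
    by case: k dk {hgk Pge vmin tA tU} => [|k] dk; [exists 0; left|exists (d k); right].
  have [dprev {}dk] := dk'.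
  have [p [hp pd pv]] := direction_descent gp gc c12 c30 Pge hgk vmin dk.
  have [tJ [gk' hgk' le]] := armijo_step_lower_bound gp gc df fL s01 g01 k0 HJ
    hgk hp pd tA tU.
  exists gk' => //; apply: le_trans le _; rewrite lerD2l.
  have t0 : 0 <= t k by apply: le_trans tJ; rewrite exprn_ge0// ltW.
  have V0 := dotv_ge0 (v k).
  have e1 : sigma * t k * (p - gk) <= sigma * t k * - (kappa * dotv (v k) (v k)).
    by rewrite ler_wpM2l// mulr_ge0// ltW.
  have e2 : gamma ^+ J * (sigma * (kappa * dotv (v k) (v k))) <=
      t k * (sigma * (kappa * dotv (v k) (v k))).
    by rewrite ler_wpM2r //; apply: mulr_ge0; [exact: ltW|rewrite mulr_ge0 // ltW].
  lra.
pose gx k := fine (g (A *m x k)).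
have gxE k : g (A *m x k) = (gx k)%:E.
  rewrite /gx; elim: k => [|k IH]; last by have [g' -> _] := step k _ IH.
  move: x0 (gp.1 (A *m x 0%N)); rewrite /edom /precomp /=.
  by case: (g _).
exists (sigma * gamma ^+ J * kappa), gx, P, v.
have vfin k : exists p, linearized f g A (x k) (v k) = p%:E.
  have [[_ Pge _] [vmin _] _ _ _] := gen k.
  by have [p hp _] := prox_step_descent gp gc c30 Pge (gxE k) vmin; exists p.
have [p hp] := choice vfin.
exists p; split; first by rewrite !mulr_gt0// exprn_gt0.
move=> k; have [[_ Pge Ple] [vmin _] _ _ _] := gen k; split=> //.
have [g' hg' le] := step k _ (gxE k).
by move: hg'; rewrite gxE => -[->].
Qed.

Lemma descent_cvg0 (R : realType) (F w : nat -> R) (beta l : R) :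
  0 < beta -> (forall k, 0 <= w k) -> (forall k, l <= F k) ->
  (forall k, F k.+1 <= F k - beta * w k) -> w k @[k --> \oo] --> (0 : R).
Proof.
move=> b0 w0 Fl Fdec.
have Fni : nonincreasing_seq F.
  apply/nonincreasing_seqP => k; apply: le_trans (Fdec k) _.
  by rewrite lerBlDr lerDl mulr_ge0// ltW.
have Fcv : cvgn F.
  by apply: nonincreasing_is_cvgn => //; exists l => _ [k _ <-].
have D0 : (F k - F k.+1) / beta @[k --> \oo] --> (0 : R).
  rewrite -[X in _ --> X](mul0r beta^-1); apply: cvgM; last exact: cvg_cst.
  rewrite -(subrr (limn F)); apply: cvgB => //.
  by rewrite (cvg_shiftS F).
apply: (squeeze_cvgr _ (cvg_cst 0) D0); apply: nearW => k; rewrite w0 /=.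
by rewrite ler_pdivlMr// mulrC; have := Fdec k; lra.
Qed.

(** The optimality condition of the proximal steps passes to the limit, the bound in
    [prox_step_variational] being jointly continuous in the iterate and the step. *)
Lemma cluster_stationary (R : realType) (m n : nat)
    (f : 'cV[R]_n -> R) (g : 'cV[R]_m -> \bar R) (A : 'M[R]_(m, n)) (c3 c4 gs : R)
    (P : nat -> 'M[R]_n) (x v : nat -> 'cV[R]_n) (p : nat -> R) (xs : 'cV[R]_n) :
  continuous (grad f) -> eproper g -> econvex g -> lower_semicontinuous g ->
  0 <= c3 -> 0 <= c4 ->
  (forall k, [/\ loewner_le c3%:M (P k), loewner_le (P k) c4%:M,
     argmin setT (prox_model f g A (P k) (x k)) (v k) &
     linearized f g A (x k) (v k) = (p k)%:E]) ->
  v @ \oo --> (0 : 'cV[R]_n) -> cluster (x @ \oo) xs -> g (A *m xs) = gs%:E ->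
  stationary f g A xs.
Proof.
move=> gradc gp gc gl c30 c40 Hk v0 xs_cl gsE.
exists (- grad f xs); last by rewrite subrr.
split; first by rewrite /edom /precomp /= gsE ltry.
move=> y; rewrite /precomp gsE.
case gyE : (g (A *m y)) (gp.1 (A *m y)) => [b| |] // _; last by rewrite leey.
rewrite -EFinD lee_fin dotvNl leNgt; apply/negP => gap.
set D := dotv (grad f xs) (y - xs) in gap.
set E := dotv (y - xs) (y - xs).
pose dl := gs - b - D.
have dl0 : 0 < dl by rewrite /dl; lra.
have cE0 : 0 <= c4 * E by rewrite mulr_ge0// dotv_ge0.
(* [t <= 1/2] and [t * c4 * |y - xs|^2 < dl / 4] *)
pose t := dl / (2 * dl + 4 * (c4 * E)).
have den0 : 0 < 2 * dl + 4 * (c4 * E) by lra.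
have t01 : 0 < t < 1.
  by rewrite divr_gt0// ltr_pdivrMr//; lra.
have tE : t * (c4 * E) < dl / 4.
  rewrite /t mulrAC ltr_pdivrMr//.
  have : 0 < dl * dl by rewrite mulr_gt0.
  lra.
pose bound (z : 'cV[R]_n * 'cV[R]_n) : R :=
  b + dotv (grad f z.1) (y - (z.1 + z.2))
  + t * (c4 * dotv (y - (z.1 + z.2)) (y - (z.1 + z.2)))
  + c4 * dotv z.2 z.2 / (2 * t).
pose z0 : 'cV[R]_n * 'cV[R]_n := (xs, 0).
have z1 : z.1 @[z --> z0] --> xs by exact: cvg_fst.
have z2 : z.2 @[z --> z0] --> (0 : 'cV[R]_n) by exact: cvg_snd.
have z12 : z.1 + z.2 @[z --> z0] --> xs.
  by rewrite -[X in _ --> X]addr0; exact: cvgD.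
have yz : y - (z.1 + z.2) @[z --> z0] --> y - xs by apply: cvgB => //; exact: cvg_cst.
have bound_cvg : bound z @[z --> z0] --> b + D + t * (c4 * E) + c4 * 0 / (2 * t).
  apply: cvgD; [apply: cvgD; [apply: cvgD|]|].
  - exact: cvg_cst.
  - by apply: cvg_dotv => //; apply: cvg_comp z1 _; exact: gradc.
  - apply: cvgM; first exact: cvg_cst.
    by apply: cvgM; [exact: cvg_cst|exact: cvg_dotv].
  - apply: cvgM; last exact: cvg_cst.
    apply: cvgM; first exact: cvg_cst.
    by rewrite -(dotv0 (0 : 'cV[R]_n)); exact: cvg_dotv.
have nb : \forall z \near z0, bound z < gs - dl / 2.
  by apply: (cvgr_lt _ bound_cvg); rewrite mulr0 mul0r /dl in tE *; lra.
have ag : ((gs - dl / 2)%:E < g (A *m xs))%E by rewrite gsE lte_fin; lra.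
have ng : \forall z \near z0, ((gs - dl / 2)%:E < g (A *m (z.1 + z.2)))%E.
  exact: (@cvg_lsc_mulmx _ _ (nbhs z0) _ _ _ g A _ xs _ gl z12 ag).
have [[U V] /= [nU nV] UV] := filterI nb ng.
have late : (x @ \oo) (x @` [set k | V (v k)]).
  have : \forall k \near \oo, V (v k) by exact: v0.
  by apply: filterS => k Vk; exists k.
have [_ [[k Vk <-] Uk]] := xs_cl _ _ late nU.
have [/= bk gk] := UV (x k, v k) (conj Uk Vk).
have [Pge Ple vmin hp] := Hk k.
have := prox_step_variational gp gc c30 Pge Ple t01 vmin hp gyE.
move=> /(lt_le_trans gk); rewrite lte_fin => H.
by have := lt_trans H bk; rewrite ltxx.
Qed.

Theorem theorem1 (R : realType) (m n : nat)
    (f : 'cV[R]_n -> R) (g : 'cV[R]_m -> \bar R) (A : 'M[R]_(m, n))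
    (L c1 c2 c3 c4 sigma gamma eps : R) (x : nat -> 'cV[R]_n)
    (f_C1 : continuously_differentiable f)
    (g_proper : eproper g) (g_convex : econvex g)
    (g_lsc : lower_semicontinuous g)
    (level_compact : forall x0 : 'cV[R]_n, edom (objective f g A) x0 ->
       compact [set y | (objective f g A y <= objective f g A x0)%E])
    (f_smooth : L_smooth L f)
    (c12 : 0 < c1 <= c2) (c34 : 0 < c3 <= c4)
    (sigma01 : 0 < sigma < 1) (gamma01 : 0 < gamma < 1) (eps_gt0 : 0 < eps)
    (x_gen : ppg_conjugate_momentum f g A c1 c2 c3 c4 sigma gamma eps x) :
  cluster (x @ \oo) !=set0 /\
  forall xstar : 'cV[R]_n, cluster (x @ \oo) xstar -> stationary f g A xstar.
Proof.
have [df gradc] := f_C1; have /andP[c30 c34'] := c34.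
have c40 : 0 <= c4 by lra.
have [beta [gx [P [v [p [b0 Hk]]]]]] :=
  iterates_descent df g_proper g_convex f_smooth c12 c30 sigma01 gamma01 x_gen.
pose Fx k := f (x k) + gx k.
have FxE k : objective f g A (x k) = (Fx k)%:E.
  by rewrite /objective; have [-> _ _ _ _] := Hk k.
have Fx_step k : Fx k.+1 <= Fx k - beta * dotv (v k) (v k).
  by have [] := Hk k.
have Fx_dec i j : (i <= j)%N -> Fx j <= Fx i.
  have : nonincreasing_seq Fx.
    apply/nonincreasing_seqP => k; apply: le_trans (Fx_step k) _.
    by rewrite lerBlDr lerDl mulr_ge0 ?dotv_ge0// ltW.
  by apply.
split.
  have x0_dom : edom (objective f g A) (x 0%N) by rewrite /edom /= FxE ltry.
  have x_level : (x @ \oo)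
      [set y | (objective f g A y <= objective f g A (x 0%N))%E].
    by exists 0%N => // k _ /=; rewrite !FxE lee_fin Fx_dec.
  by have [xs [_ xs_cl]] := level_compact _ x0_dom _ _ x_level; exists xs.
move=> xs xs_cl.
have fc : continuous f by move=> y; exact: differentiable_continuous.
have Fxs := cluster_objective_le g_lsc fc FxE Fx_dec xs_cl.
have [gs gsE] : exists gs, g (A *m xs) = gs%:E.
  move: (Fxs 0%N) (g_proper.1 (A *m xs)); rewrite /objective.
  by case: (g _) => // r _ _; exists r.
have v0 : v @ \oo --> (0 : 'cV[R]_n).
  apply: cvg_dotv0; apply: (descent_cvg0 b0 _ _ Fx_step (l := f xs + gs)).
    by move=> k; exact: dotv_ge0.
  by move=> k; have := Fxs k; rewrite /objective gsE -EFinD lee_fin.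
have steps k : [/\ loewner_le c3%:M (P k), loewner_le (P k) c4%:M,
    argmin setT (prox_model f g A (P k) (x k)) (v k) &
    linearized f g A (x k) (v k) = (p k)%:E].
  by have [_ _ Pge Ple [vmin hp]] := Hk k; split.
exact: (cluster_stationary gradc g_proper g_convex g_lsc (ltW c30) c40 steps v0
  xs_cl gsE).
Qed.
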